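(* For every integer $k\geq 2$, let $G$ be a $k$-connected graph with minimum degree $\delta$ and let $X$ be a longest cycle in $G$. Let $p:=p(G-X)$. Then $$|X|>\frac{(\min\{k,p\}-2)\cdot\delta}{25}.$$
   Context: All graphs are finite and simple. The length of a path or cycle is its number of edges, and $|X|$ is the length of the cycle $X$. $G-X$ is the graph obtained from $G$ by deleting all vertices of $X$. For a graph $F$, $p(F)$ denotes the length of a longest path in $F$, with $p(F):=0$ if $F$ is the empty graph. *)

(* Defs.v *)
From mathcomp Require Import all_boot.

Set Implicit Arguments.
Unset Strict Implicit.
Unset Printing Implicit Defensive.

Record sgraph := SGraph {
  vertex :> finType;
  adj : rel vertex;
  adj_sym : symmetric adj;
  adj_irrefl : irreflexive adj }.

Definition nbhd (G : sgraph) (x : G) : {set G} := [set y | adj x y].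

Definition degree (G : sgraph) (x : G) : nat := #|nbhd x|.

(* The default #|G| strictly exceeds every degree, so for nonempty G this is
   the minimum of the degrees. *)
Definition min_degree (G : sgraph) : nat := \big[minn/#|G|]_(x : G) degree x.

Section Deletion.
Variables (G : sgraph) (S : {set G}).

Definition del_adj : rel {x : G | x \notin S} :=
  fun x y => adj (val x) (val y).

Lemma del_adj_sym : symmetric del_adj.
Proof. by move=> x y; apply: adj_sym. Qed.

Lemma del_adj_irrefl : irreflexive del_adj.
Proof. by move=> x; apply: adj_irrefl. Qed.

Definition del_vertices : sgraph := SGraph del_adj_sym del_adj_irrefl.

End Deletion.

Definition connected_graph (G : sgraph) : Prop :=
  forall x y : G, connect (@adj G) x y.

Definition k_connected (k : nat) (G : sgraph) : Prop :=
  k < #|G| /\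
  forall S : {set G}, #|S| < k -> connected_graph (del_vertices S).

(* A cycle is given by the cyclic sequence of its distinct vertices, so its
   length (number of edges) is the size of the sequence; the bound on the size
   excludes the degenerate cases accepted by ucycleb. *)
Definition is_cycle (G : sgraph) (c : seq G) : bool :=
  (2 < size c) && ucycleb (@adj G) c.

Definition is_longest_cycle (G : sgraph) (c : seq G) : Prop :=
  is_cycle c /\ forall c' : seq G, is_cycle c' -> size c' <= size c.

(* A path is given by the nonempty sequence of its distinct vertices; a path
   with n edges has n.+1 vertices. *)
Definition is_path (G : sgraph) (s : seq G) : bool :=
  [&& s != [::], sorted (@adj G) s & uniq s].

(* A path has at most #|F| vertices, so the range n < #|F| is no restriction;
   for the empty graph the maximum is over no indices, hence 0. *)
Definition longest_path_length (F : sgraph) : nat :=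
  \max_(n < #|F| | [exists t : n.+1.-tuple F, is_path t]) n.

(* Main.v *)
(* Let d be the minimum degree, m = min(k, p) and s = m %/ 3, and call a vertex
   off X rich when it has at least d/3 neighbours on X.  Let P be a longest path
   of G - X.  If G - X contains s disjoint paths from P to rich vertices, then
   detours from X through these paths and P force long gaps on X between the
   attached vertices, and counting gives 18 |X| > (m - 2) d.  Otherwise, by
   Menger's theorem, fewer than s vertices separate P from the rich vertices in
   G - X; the part of G - X around P that is left has minimum degree more than
   d/3, hence contains a cycle C of length more than d/3.  By k-connectivity
   there are min(k, |C|) disjoint paths from C to X, any two ends of which are
   joined by a detour through at least half of C, so again 18 |X| > (m - 2) d.
   Small m is covered by |X| > d. *)
Require Import Defs.
From mathcomp Require Import all_boot all_order all_algebra zify.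

Set Implicit Arguments.
Unset Strict Implicit.
Unset Printing Implicit Defensive.

(** * Menger's theorem for directed graphs *)

Definition separates (T : finType) (e : rel T) (A B S : {set T}) : Prop :=
  forall a s, a \in A -> path e a s -> last a s \in B -> has [in S] (a :: s).

(** [A'] records the starting vertices and [f a] the rest of the walk from [a], empty for a
    one-vertex walk. Walks from distinct starts are disjoint, but a single walk may repeat
    vertices. *)
Definition linkage (T : finType) (e : rel T) (A B A' : {set T})
    (f : T -> seq T) : Prop :=
  [/\ A' \subset A,
      forall a, a \in A' -> path e a (f a) /\ last a (f a) \in B
    & forall a b v, a \in A' -> b \in A' ->
        v \in a :: f a -> v \in b :: f b -> a = b].

(** Avoidance of [S] before the hit is put into the relation, so the prefix is a path of a smaller
    relation, to which an induction on arcs applies. *)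
Lemma path_first_hit (T : finType) (e : rel T) (S : {set T}) a s :
  path e a s -> has [in S] (a :: s) ->
  exists s1 s2, [/\ s = s1 ++ s2, last a s1 \in S
    & path (fun u v => e u v && (u \notin S)) a s1].
Proof.
elim: s a => [|b s IHs] a /=; first by rewrite orbF; exists [::], [::].
case/andP=> eab ps; case aS: (a \in S) => /= hS; first by exists [::], (b :: s).
have [s1 [s2 [-> lS ps1]]] := IHs b ps hS.
by exists (b :: s1), s2; rewrite /= eab aS.
Qed.

Lemma path_last_hit (T : finType) (e : rel T) (S : {set T}) a s :
  path e a s -> has [in S] (a :: s) ->
  exists b s1 s2, [/\ a :: s = s1 ++ b :: s2, b \in S
    & path (fun u v => e u v && (v \notin S)) b s2].
Proof.
elim: s a => [|b s IHs] a /=.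
  by rewrite orbF => _ aS; exists a, [::], [::].
case/andP=> eab ps.
case hS: (has [in S] (b :: s)); last first.
  move=> h; have aS: a \in S by move: h hS => /=; case: (a \in S) => //= ->.
  exists a, [::], (b :: s); split=> //=.
  move/negbT: hS; rewrite -all_predC => /= /andP[bS sS].
  rewrite eab bS /=.
  elim: s b ps sS {IHs eab bS h} => //= c s IHs b /andP[ebc ps] /andP[cS sS].
  by rewrite ebc cS IHs.
move=> _; have [c [s1 [s2 [-> cS ps2]]]] := IHs b ps hS.
by exists c, (a :: s1), s2.
Qed.

Lemma in_belast_path (T : finType) (e : rel T) (S : {set T}) a s :
  path (fun u v => e u v && (u \notin S)) a s ->
  forall v, v \in belast a s -> v \notin S.
Proof.
elim: s a => //= b s IHs a /andP[/andP[_ aS] ps] v.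
by rewrite inE => /orP[/eqP-> //|]; apply: IHs.
Qed.

Lemma in_tail_path (T : finType) (e : rel T) (S : {set T}) a s :
  path (fun u v => e u v && (v \notin S)) a s ->
  forall v, v \in s -> v \notin S.
Proof.
elim: s a => //= b s IHs a /andP[/andP[_ bS] ps] v.
by rewrite inE => /orP[/eqP-> //|]; apply: IHs ps v.
Qed.

(** A walk of [f] and a walk of [g] meet only in a vertex of [S] that ends the one and starts the
    other: at any other common vertex, switching walks would give a walk of [e'] from [A] to [B]
    that misses [S]. So gluing keeps distinct walks disjoint. *)
Lemma menger_step (T : finType) (e : rel T) (A B S A1 A2 : {set T}) x y f g :
  let e' := fun u v => e u v && ((u, v) != (x, y)) in
  e x y -> x \notin S -> y \notin S -> separates e' A B S ->
  linkage (fun u v => e' u v && (u \notin x |: S)) A (x |: S) A1 f ->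
  linkage (fun u v => e' u v && (v \notin y |: S)) (y |: S) B A2 g ->
  #|A1| = #|S|.+1 -> #|A2| = #|S|.+1 ->
  exists h, linkage e A B A1 h.
Proof.
move=> e' exy xS yS sepS [sA1 f1 f2] [sA2 g1 g2] c1 c2.
have A2E : A2 = y |: S.
  by apply/eqP; rewrite eqEcard sA2 c2 cardsU1 yS add1n leqnn.
pose l a := last a (f a).
pose h a := f a ++ (if l a == x then y :: g y else g (l a)).
(* [r a] starts the second half: the walk ending in [x] crosses the arc to [y], the others continue
   from their own end in [S]. *)
pose r a := if l a == x then y else l a.
have lS a : a \in A1 -> l a \in x |: S by move=> /f1[].
have rA2 a : a \in A1 -> r a \in A2.
  move=> /lS; rewrite A2E /r !inE; case: eqP => [|_ /= ->]; first by rewrite eqxx.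
  by rewrite orbT.
have meet a b v : a \in A1 -> b \in A2 -> v \in a :: f a -> v \in b :: g b ->
    v \in S /\ v = l a /\ v = b.
  move=> aA1 bA2 va vb.
  have [pa _] := f1 a aA1; have [pb lb] := g1 b bA2.
  have sub1 : subrel (fun u v => e' u v && (u \notin x |: S)) e' by move=> ? ? /andP[].
  have sub2 : subrel (fun u v => e' u v && (v \notin y |: S)) e' by move=> ? ? /andP[].
  have vS : v \in S.
    apply/negPn/negP => vS.
    have /splitPl va' := va; case: va' pa => s1 s2 lv.
    rewrite cat_path => /andP[ps1 _].
    have /splitPl vb' := vb; case: vb' pb lb => t1 t2 lv'.
    rewrite cat_path last_cat lv' => /andP[_ pt2] lt2.
    have := sepS a (s1 ++ t2) (subsetP sA1 _ aA1).
    rewrite cat_path (sub_path sub1 ps1) last_cat lv (sub_path sub2 pt2).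
    move=> /(_ isT lt2) /hasP[u]; rewrite -cat_cons mem_cat => /orP[us1|ut2] uS.
      move: us1; rewrite lastI lv mem_rcons inE => /orP[/eqP uv|us1].
        by rewrite -uv uS in vS.
      by have := in_belast_path ps1 us1; rewrite !inE uS orbT.
    by have := in_tail_path pt2 ut2; rewrite !inE uS orbT.
  split=> //; split.
    move: va; rewrite lastI mem_rcons inE => /orP[/eqP //|vb'].
    by have := in_belast_path pa vb'; rewrite !inE vS orbT.
  move: vb; rewrite inE => /orP[/eqP //|vb'].
  by have := in_tail_path pb vb'; rewrite !inE vS orbT.
have hE a v : v \in a :: h a -> v \in a :: f a \/ v \in r a :: g (r a).
  rewrite /h /r -cat_cons mem_cat => /orP[->|]; first by left.
  by case: ifP => _ vg; right=> //; rewrite inE vg orbT.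
have r_inj a b : a \in A1 -> b \in A1 -> r a = r b -> a = b.
  move=> aA bA rab; have lab : l a = l b.
    move: rab (lS a aA) (lS b bA); rewrite /r !inE.
    case: (l a =P x) => [->|_]; case: (l b =P x) => [->|_] //= E.
      by rewrite -E (negPf yS).
    by rewrite E (negPf yS).
  apply: (f2 a b (l a) aA bA); first by rewrite mem_last.
  by rewrite lab mem_last.
have cross a b v : a \in A1 -> b \in A1 ->
    v \in a :: f a -> v \in r b :: g (r b) -> a = b.
  move=> aA bA va vb; have [vS [vl vr]] := meet a (r b) v aA (rA2 b bA) va vb.
  apply: r_inj => //; rewrite -vr /r -vl; case: eqP => // vx.
  by rewrite -vx vS in xS.
exists h; split=> // [a aA|a b v aA bA].
  have [pa la] := f1 a aA; have [pg lg] := g1 _ (rA2 a aA).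
  have pa' : path e a (f a) by apply: sub_path pa => ? ? /andP[/andP[]].
  have pg' : path e (r a) (g (r a)) by apply: sub_path pg => ? ? /andP[/andP[]].
  rewrite /h cat_path last_cat -/(l a) pa' /=.
  move: pg' lg; rewrite /r; case: eqP => [->|_] //= -> ->.
  by rewrite exy.
move=> /hE[va|va] /hE[vb|vb].
- exact: f2 va vb.
- exact: cross va vb.
- by apply/esym; apply: cross vb va.
- by apply: r_inj => //; apply: g2 va vb; apply: rA2.
Qed.

(* Goering's proof: delete one arc (x, y); either a smallest separator is still
   of size n, or some S of size n - 1 separates after the deletion, and then
   linkages from A to x |: S and from y |: S to B are glued along S and the arc
   (x, y). *)
Theorem menger (T : finType) (e : rel T) (A B : {set T}) n :
  (forall S, separates e A B S -> n <= #|S|) ->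
  exists A' f, linkage e A B A' f /\ #|A'| = n.
Proof.
have [N] := ubnP #|[pred uv : T * T | e uv.1 uv.2]|.
elim: N => // N IHN in e A B n *; rewrite ltnS => leN sepn.
have [[x y] /= exy|e0] := pickP [pred uv : T * T | e uv.1 uv.2]; last first.
  (* Without arcs all walks have one vertex, so [A :&: B] separates. *)
  have: n <= #|A :&: B|.
    apply: sepn => a [|b s] /= aA; first by rewrite orbF inE aA => _ ->.
    by have /= -> := e0 (a, b).
  rewrite -bin_gt0 -cards_draws => /card_gt0P[A']; rewrite inE => /andP[sA' /eqP cA'].
  exists A', (fun _ => [::]); split=> //; split=> [|a|a b v aA bA].
  - by apply: subset_trans sA' _; apply: subsetIl.
  - by move=> /(subsetP sA'); rewrite inE => /andP[_ ->].
  - by rewrite !inE => /eqP-> /eqP.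
pose e' := fun u v => e u v && ((u, v) != (x, y)).
have lt_e (d : rel T) : subrel d e' -> #|[pred uv : T * T | d uv.1 uv.2]| < N.
  move=> de; apply: leq_trans leN; apply: proper_card; apply/properP; split.
    by apply/subsetP => -[u v]; rewrite !inE /= => /de /andP[].
  exists (x, y); rewrite !inE //=; apply/negP => /de.
  by rewrite /e' eqxx andbF.
(* Boolean form of: fewer than [n] vertices never separate in [e']. The conjunct [a \notin S] is
   needed for one-vertex walks, on which [connect] tests nothing. *)
have [sepn'|] := boolP [forall S : {set T}, (#|S| < n) ==>
    [exists a in A, exists b in B,
      connect (fun u v => [&& e' u v, u \notin S & v \notin S]) a b && (a \notin S)]].
  have [||A' [f [[sA f1 f2] cA']]] := IHN e' A B n; first exact: lt_e.
    move=> S sepS; rewrite leqNgt; apply/negP => ltn.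
    have /forallP/(_ S)/implyP/(_ ltn) := sepn'.
    case/existsP=> a /andP[aA] /existsP[b /andP[bB]] /andP[/connectP[s ps lb] aS].
    have ps' : path e' a s by apply: sub_path ps => ? ? /and3P[].
    have := sepS a s aA ps'; rewrite -lb => /(_ bB).
    rewrite /= (negPf aS) /= => /hasP[u us uS].
    suff: u \notin S by rewrite uS.
    apply: (@in_tail_path _ e' S a s) us.
    by apply: sub_path ps => ? ? /and3P[-> _ ->].
  exists A', f; split=> //; split=> // a /f1[pa]; split=> //.
  by apply: sub_path pa => ? ? /andP[].
case/forallPn=> S; rewrite negb_imply => /andP[ltS /existsP nS].
have sepS : separates e' A B S.
  move=> a s aA ps lB; apply/negPn/negP => hS; apply: nS; exists a; rewrite aA /=.
  apply/existsP; exists (last a s); rewrite lB /=.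
  move: hS; rewrite -all_predC /= => /andP[aS sS]; rewrite aS andbT.
  apply/connectP; exists s => //.
  elim: s a ps aS sS {aA lB} => //= b s IHs a /andP[-> ps] aS /andP[bS sS].
  by rewrite aS bS IHs.
(* A walk of [e] that is not a walk of [e'] uses the deleted arc, hence visits both [x] and [y]. *)
have sepz z : (z == x) || (z == y) -> separates e A B (z |: S).
  move=> zxy a s aA ps lB; have [ps'|nps] := boolP (path e' a s).
    have /hasP[u us uS] := sepS a s aA ps' lB.
    by apply/hasP; exists u => //; rewrite inE uS orbT.
  suff zs: z \in a :: s by apply/hasP; exists z => //; rewrite !inE eqxx.
  have /andP[xs ys] : (x \in a :: s) && (y \in a :: s).
    elim: s a ps nps {aA lB} => //= b s IHs a /andP[eab ps].
    rewrite /e' eab /= negb_and negbK => /orP[/eqP[-> ->]|]; last first.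
      by move=> /(IHs b ps) /andP[]; rewrite !inE => -> ->; rewrite !orbT.
    by rewrite !inE !eqxx orbT.
  by case/orP: zxy => /eqP->.
have cS z : (z == x) || (z == y) -> z \notin S /\ n = #|S|.+1.
  move=> /sepz/sepn; rewrite cardsU1; case: (z \in S) => /= le_n; last by split=> //; lia.
  lia.
have [xS nS1] := cS x (predU1l _ (erefl x)).
have [yS _] : y \notin S /\ n = #|S|.+1 by apply: cS; rewrite eqxx orbT.
have [||A1 [f [lf c1]]] :=
    IHN (fun u v => e' u v && (u \notin x |: S)) A (x |: S) n.
- by apply: (@lt_e (fun u v => e' u v && (u \notin x |: S))) => ? ? /andP[].
(* The part of an [A]-[B] walk up to its first vertex in [x |: S] never leaves [x], so it avoids the
   deleted arc and must meet [S']. *)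
- move=> S' sepS'; apply: sepn => a s aA ps lB.
  have hS : has [in x |: S] (a :: s) by apply: sepz => //; rewrite eqxx.
  have [s1 [s2 [sE lS ps1]]] := path_first_hit ps hS.
  rewrite sE -cat_cons has_cat (sepS' a s1) // => {lS}.
  apply: sub_path ps1 => u v /andP[euv uS]; rewrite /e' euv uS andbT /=.
  by apply: contraNneq uS => -[-> _]; rewrite !inE eqxx.
have [||A2 [g [lg c2]]] :=
    IHN (fun u v => e' u v && (v \notin y |: S)) (y |: S) B n.
- by apply: (@lt_e (fun u v => e' u v && (v \notin y |: S))) => ? ? /andP[].
- move=> S' sepS'; apply: sepn => a s aA ps lB.
  have hS : has [in y |: S] (a :: s) by apply: sepz => //; rewrite eqxx orbT.
  have [b [s1 [s2 [sE bS ps2]]]] := path_last_hit ps hS.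
  rewrite sE has_cat (sepS' b s2) ?orbT //.
    apply: sub_path ps2 => u v /andP[euv vS]; rewrite /e' euv vS andbT /=.
    by apply: contraNneq vS => -[_ ->]; rewrite !inE eqxx.
  by move: lB; rewrite -[last a s]/(last a (a :: s)) sE last_cat.
have [h lh] := menger_step exy xS yS sepS lf lg (etrans c1 nS1) (etrans c2 nS1).
by exists A1, h.
Qed.

(** Menger's theorem is applied after removing all arcs into [A] and out of [B]. Every walk from [A]
    to [B] keeps a segment from its last vertex in [A] to the next one in [B], so separators get no
    smaller; shortening then removes repetitions. *)
Corollary menger_trimmed (T : finType) (e : rel T) (A B : {set T}) n :
  (forall S, separates e A B S -> n <= #|S|) ->
  exists A' f, [/\ linkage e A B A' f, #|A'| = n
    & forall a, a \in A' -> [/\ uniq (a :: f a),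
        forall v, v \in f a -> v \notin A
      & forall v, v \in belast a (f a) -> v \notin B]].
Proof.
move=> sepn.
have [S sepS|A' [f [[sA f1 f2] cA']]] :=
    @menger T (fun u v => (e u v && (v \notin A)) && (u \notin B)) A B n.
  apply: sepn => a s aA ps lB.
  have hA : has [in A] (a :: s) by rewrite /= aA.
  have [b [s1 [s2 [sE bA ps2]]]] := path_last_hit ps hA.
  have hB : has [in B] (b :: s2).
    apply/hasP; exists (last b s2); first exact: mem_last.
    by move: lB; rewrite -[last a s]/(last a (a :: s)) sE last_cat.
  have [t1 [t2 [s2E lt1 pt1]]] := path_first_hit ps2 hB.
  by rewrite sE s2E has_cat -cat_cons has_cat (sepS b t1) // orbT.
exists A', (fun a => shorten a (f a)); split=> //.
  split=> // [a aA'|a b v aA bA].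
    have [pa la] := f1 a aA'; case/shortenP: pa la => s' ps' _ _ lb; split=> //.
    by apply: sub_path ps' => ? ? /andP[/andP[]].
  have [pa _] := f1 a aA; have [pb _] := f1 b bA.
  case/shortenP: pa (f2 a b v aA bA) => s _ _ ss; case/shortenP: pb => t _ _ st f2' vs vt.
  apply: f2'.
    by move: vs; rewrite !inE => /orP[->|/ss ->]; rewrite ?orbT.
  by move: vt; rewrite !inE => /orP[->|/st ->]; rewrite ?orbT.
move=> a aA'; have [pa la] := f1 a aA'; case/shortenP: pa la => s' ps' us _ lb; split=> //.
  by apply: (@in_tail_path _ e A a); apply: sub_path ps' => ? ? /andP[].
exact: in_belast_path ps'.
Qed.

(** * Detours and gaps on a longest cycle *)

Lemma iter_next_cons (T : eqType) (x : T) s j : uniq (x :: s) ->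
  iter j (next (x :: s)) x = nth x (x :: s) (j %% (size s).+1).
Proof.
move=> us; elim: j => [|j IHj]; first by rewrite mod0n.
have lt_j : j %% (size s).+1 < (size s).+1 by rewrite ltn_mod.
rewrite iterS IHj next_nth mem_nth // index_uniq // -[j.+1]addn1 -modnDml addn1.
have [lt_js | ge_js] := ltnP (j %% (size s).+1) (size s).
  by rewrite (@modn_small _.+1) //= ltnS.
have -> : j %% (size s).+1 = size s by lia.
by rewrite modnn nth_default.
Qed.

(** [Q] lists the inner vertices only, so the path from [x] to [y] has at least [n.+1] edges. *)
Definition detour (G : sgraph) (X : seq G) (x y : G) (n : nat) : Prop :=
  exists Q, [/\ path (@adj G) x (rcons Q y), uniq Q,
    forall v, v \in Q -> v \notin X & n <= size Q].

Lemma longest_cycle_uniq (G : sgraph) (X : seq G) : is_longest_cycle X -> uniq X.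
Proof. by case=> /andP[_ /andP[]]. Qed.

Lemma next_longest_rot (G : sgraph) (X : seq G) (x : G) :
  is_longest_cycle X -> x \in X ->
  exists s, [/\ next X =1 next (x :: s), X =i x :: s, uniq (x :: s),
    size X = (size s).+1 & cycle (@adj G) (x :: s)].
Proof.
move=> hX xX; have [i s Es] := rot_to xX; exists s.
rewrite -Es rot_uniq rot_cycle; have [/andP[_ /andP[-> ->]] _] := hX.
split=> //; first by move=> z; rewrite next_rot // (longest_cycle_uniq hX).
  by move=> z; rewrite mem_rot.
by rewrite -(size_rot i X) Es.
Qed.

(** Replacing the stretch of [X] from [x] to [y] by the detour gives a cycle, which cannot be longer
    than [X]; so the stretch has at least [n] inner vertices. *)
Lemma detour_gap (G : sgraph) (X : seq G) (x y : G) n j :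
  is_longest_cycle X -> x \in X -> y \in X -> x != y -> 0 < n ->
  detour X x y n -> iter j (next X) x = y -> n < j.
Proof.
move=> hX xX yX xy n_gt0 [Q [pQ uQ QX nQ]] itj.
have [s [nE XE us sX cs]] := next_longest_rot hX xX.
have yE : y = nth x (x :: s) (j %% (size s).+1).
  by rewrite -iter_next_cons // -itj; apply: eq_iter.
(* The [j] steps may wrap around [X]; the bound is shown for the remainder. *)
set i := j %% _ in yE; have le_ij : i <= j := leq_mod _ _.
have lt_is : i < (size s).+1 by rewrite ltn_mod.
case: i => [|i] in yE le_ij lt_is; first by rewrite yE eqxx in xy.
apply: leq_trans le_ij; rewrite ltnS; apply: leq_trans (nQ) _.
have sE : s = take i s ++ y :: drop i.+1 s.
  by rewrite yE /= -drop_nth // cat_take_drop.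
have sz : size s = i + (size (drop i.+1 s)).+1.
  by rewrite [in LHS]sE size_cat (size_takel (ltnW (lt_is : i < size s))).
set s2 := drop i.+1 s in sE sz; set s1 := take i s in sE.
have [_ maxX] := hX.
suff /maxX : is_cycle (x :: Q ++ y :: s2).
  by rewrite sX /= size_cat /= sz ltnS leq_add2r.
have Q_gt0 : 0 < size Q by apply: leq_trans nQ.
apply/andP; split; first by rewrite /= size_cat /=; lia.
apply/andP; split.
  move: cs; rewrite sE /= !rcons_cat !cat_path /= => /and3P[_ _ ->].
  by move: pQ; rewrite rcons_path => /andP[-> ->].
have QX' v : v \in x :: s -> v \notin Q.
  by rewrite -XE => vX; apply/negP => /QX; rewrite vX.
move: us; rewrite sE /= cat_uniq mem_cat inE !negb_or /=.
case/and3P=> /and3P[xs1 _ xs2] _ /and3P[_ ys2 us2].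
rewrite cat_uniq mem_cat inE !negb_or /= uQ xy xs2 ys2 us2 (QX' x) ?mem_head //=.
rewrite andbT (QX' y) -?XE //=; apply/hasPn => v vs2 /=; apply: QX'.
by rewrite sE inE mem_cat inE vs2 !orbT.
Qed.

(* The vertices met in the first g x steps after x, for x in W, are pairwise
   distinct, so no ordering of W along the cycle is needed. *)
Lemma sum_gaps (G : sgraph) (X : seq G) (W : {set G}) (g : G -> nat) :
  is_longest_cycle X -> 1 < #|W| -> {subset W <= X} ->
  (forall x y j, x \in W -> y \in W -> x != y -> iter j (next X) x = y -> g x < j) ->
  \sum_(x in W) (g x).+1 <= size X.
Proof.
move=> hX W_gt1 sWX gapW; have uX := longest_cycle_uniq hX.
have inj_next : injective (next X) := can_inj (prev_next uX).
have inj_iter j : injective (iter j (next X)).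
  by elim: j => // j IHj x y /= /inj_next/IHj.
(* If [x] returned to itself after [r] steps, every other vertex of [W] would be met within fewer
   than [r] steps, against its gap. Here [W] needs a second vertex. *)
have no_return x r : x \in W -> 0 < r -> r <= g x -> iter r (next X) x != x.
  move=> xW r_gt0 le_r; apply/eqP => itr.
  have [y yW yx] : exists2 y, y \in W & y != x.
    have : 0 < #|W :\ x| by rewrite (cardsD1 x W) xW in W_gt1.
    by case/card_gt0P=> y; rewrite !inE => /andP[yx yW]; exists y.
  have [s [nE XE us sX _]] := next_longest_rot hX (sWX x xW).
  have yt : iter (index y (x :: s)) (next X) x = y.
    have ys : y \in x :: s by rewrite -XE sWX.
    have lt_y : index y (x :: s) < (size s).+1 by rewrite -index_mem in ys.
    by rewrite (eq_iter nE) iter_next_cons // modn_small // nth_index.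
  have it_mul q : iter (q * r) (next X) x = x.
    by elim: q => // q IHq; rewrite mulSn iterD IHq.
  move: yt; set t := index _ _; rewrite (divn_eq t r) addnC iterD it_mul => yt.
  have := gapW x y _ xW yW; rewrite eq_sym yx => /(_ _ isT yt).
  by have := ltn_pmod t r_gt0; lia.
pose L := [seq iter j (next X) x | x <- enum W, j <- iota 0 (g x).+1].
have key x y i j : x \in W -> y \in W -> i <= g x -> j <= i ->
    iter i (next X) x = iter j (next X) y -> x = y /\ i = j.
  move=> xW yW le_i le_ji; rewrite -{1}(subnKC le_ji) iterD => /inj_iter itE.
  have [xy|xy] := eqVneq x y; last first.
    by have := leq_trans (gapW x y _ xW yW xy itE) (leq_subr j i); rewrite ltnNge le_i.
  split=> //; have [//|neq] := eqVneq i j.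
  have r_gt0 : 0 < i - j by lia.
  have := no_return x (i - j) xW r_gt0 (leq_trans (leq_subr j i) le_i).
  by rewrite itE xy eqxx.
have uL : uniq L.
  apply: allpairs_uniq_dep => [|x _|]; rewrite ?enum_uniq ?iota_uniq //.
  move=> _ _ /allpairsPdep[x [i [xW ig ->]]] /allpairsPdep[y [j [yW jg ->]]] /=.
  move: xW yW ig jg; rewrite !mem_enum !mem_iota /= !add0n !ltnS => xW yW ig jg itE.
  have [le_ji|/ltnW le_ij] := leqP j i.
    by have [-> ->] := key x y i j xW yW ig le_ji itE.
  by have [-> ->] := key y x j i yW xW jg le_ij (esym itE).
have sLX : {subset L <= X}.
  move=> _ /allpairsPdep[x [i [xW _ ->]]]; rewrite mem_enum in xW.
  by elim: i => [|i IHi] /=; rewrite ?mem_next // sWX.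
apply: leq_trans (uniq_leq_size uL sLX).
rewrite size_allpairs_dep sumnE big_map big_enum /=.
by under [leqRHS]eq_bigr do rewrite size_iota.
Qed.

(** * Building detours from linkages, paths and cycles *)

(** The detour runs back along [p], through [A] by [a :: t], and out along [q]. Only the vertices of
    [a :: t] are counted. *)
Lemma linkage_detour (G : sgraph) (X : seq G) (A : {set G}) (a b x y : G)
    (p q t : seq G) :
  (forall v, v \in A -> v \notin X) ->
  path (@adj G) a (rcons p x) -> path (@adj G) b (rcons q y) ->
  uniq p -> uniq q ->
  (forall v, v \in p -> v \notin A) -> (forall v, v \in q -> v \notin A) ->
  (forall v, v \in p -> v \notin X) -> (forall v, v \in q -> v \notin X) ->
  (forall v, v \in p -> v \notin q) ->
  path (@adj G) a t -> last a t = b -> uniq (a :: t) ->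
  (forall v, v \in a :: t -> v \in A) ->
  detour X x y (size t).+1.
Proof.
move=> AX pp pq up uq pA qA pX qX dpq pt lt ut tA.
exists (rev p ++ (a :: t) ++ q); split.
- rewrite rcons_cat cat_path /= rcons_cat cat_path pt lt pq !andbT.
  move: pp; rewrite -rev_path last_rcons belast_rcons rev_cons -cats1.
  rewrite (eq_path (e' := @adj G)); last by move=> u v; rewrite /= adj_sym.
  by rewrite cat_path /= andbT.
- rewrite !cat_uniq rev_uniq up uq ut andTb andbT; apply/andP; split.
    apply/hasPn => v; rewrite mem_cat => /orP[/tA vA|vq].
      by apply/negP; rewrite /= mem_rev => /pA; rewrite vA.
    by rewrite /= mem_rev; apply: contraL vq; apply: dpq.
  by apply/hasPn => v vq; apply/negP => /tA; apply/negP/qA.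
- by move=> v; rewrite !mem_cat mem_rev => /or3P[/pX|/tA/AX|/qX].
- by rewrite !size_cat /=; lia.
Qed.

(** One of the two truncated differences is zero, so their sum is the distance of [a] and [b] along
    [P]. *)
Lemma path_between (G : sgraph) (P : seq G) a b :
  sorted (@adj G) P -> uniq P -> a \in P -> b \in P ->
  exists t, [/\ path (@adj G) a t, last a t = b, uniq (a :: t),
    {subset a :: t <= P}
    & size t = (index a P - index b P) + (index b P - index a P)].
Proof.
have fwd u v : sorted (@adj G) P -> uniq P -> u \in P -> v \in P ->
  index u P <= index v P ->
  exists t, [/\ path (@adj G) u t, last u t = v, uniq (u :: t),
    {subset u :: t <= P} & size t = index v P - index u P].
  move=> sP uP uinP vP.
  pose t := take (index v P - index u P) (drop (index u P).+1 P).
  move=> le_uv; exists t.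
  have tE : u :: t = take (index v P - index u P).+1 (drop (index u P) P).
    by rewrite (drop_nth u) ?index_mem //= nth_index.
  have lt_v : index v P < size P by rewrite index_mem.
  have st : size t = index v P - index u P.
    by rewrite size_takel // size_drop; lia.
  split=> //.
  - by have := take_sorted (index v P - index u P).+1 (drop_sorted (index u P) sP); rewrite -tE.
  - rewrite (last_nth u) st tE nth_take // nth_drop subnKC // nth_index //.
  - by rewrite tE take_uniq // drop_uniq.
  - by move=> w; rewrite tE => /mem_take/mem_drop.
move=> sP uP aP bP; have [le_ab|/ltnW le_ba] := leqP (index a P) (index b P).
  have [t [? ? ? ? st]] := fwd a b sP uP aP bP le_ab.
  by exists t; split=> //; rewrite st; lia.
have [t [pt lt ut sub st]] := fwd b a sP uP bP aP le_ba.
have E : a :: rev (belast b t) = rev (b :: t) by rewrite [b :: t]lastI lt rev_rcons.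
exists (rev (belast b t)); split.
- rewrite -lt rev_path (eq_path (e' := @adj G)) // => u v.
  by rewrite /= adj_sym.
- by rewrite -[LHS]/(last a (a :: rev (belast b t))) E rev_cons last_rcons.
- by rewrite E rev_uniq.
- by move=> w; rewrite E mem_rev; apply: sub.
- by rewrite size_rev size_belast st; lia.
Qed.

(** [t] follows the longer of the two arcs of [C] between [a] and [b]. *)
Lemma cycle_between (G : sgraph) (C : seq G) a b :
  is_cycle C -> a \in C -> b \in C -> a != b ->
  exists t, [/\ path (@adj G) a t, last a t = b, uniq (a :: t),
    {subset a :: t <= C} & size C <= 2 * size t].
Proof.
move=> /andP[_ /andP[cC uC]] aC bC ab; have [i s Es] := rot_to aC.
have sC : size C = (size s).+1 by rewrite -(size_rot i) Es.
have mC v : (v \in C) = (v \in a :: s) by rewrite -(mem_rot i) Es.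
move: cC uC bC; rewrite -(rot_cycle i) -(rot_uniq i) mC Es inE eq_sym (negPf ab) /=.
move=> cs /andP[as_ us] bs; case/splitPr: bs => s1 s2 in sC mC cs as_ us *.
have usub t : subseq t (s1 ++ b :: s2) -> uniq (a :: t) /\ {subset a :: t <= C}.
  move=> st; split=> /=.
    rewrite (subseq_uniq st us) andbT; apply: contra as_; exact: (mem_subseq st).
  by move=> v; rewrite mC !inE => /orP[->//|/(mem_subseq st) ->]; rewrite orbT.
move: cs; rewrite rcons_cat cat_path /= => /and3P[ps1 eb ps2].
have [le_s|lt_s] := leqP (size s2) (size s1).
  have [|u sub] := usub (rcons s1 b).
    by rewrite -cats1 cat_subseq //= eqxx sub0seq.
  exists (rcons s1 b); split=> //; rewrite ?last_rcons // ?rcons_path ?ps1 //.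
  by rewrite sC size_cat size_rcons /=; move: (size s1) (size s2) le_s => m n; lia.
have [u sub] := usub (b :: s2) (suffix_subseq _ _).
exists (rev (b :: s2)); split.
- move: ps2; rewrite -rev_path last_rcons belast_rcons.
  by rewrite (eq_path (e' := @adj G)) // => v w; rewrite /= adj_sym.
- by rewrite rev_cons last_rcons.
- by rewrite mem_rev rev_uniq.
- by move=> v vt; apply: sub; rewrite !inE mem_rev in vt *.
- by rewrite sC size_cat size_rev /=; move: (size s1) (size s2) lt_s => m n; lia.
Qed.

(** * Long cycles from large degree *)

(** All neighbours in [K] of the first vertex of a longest path in [K] lie on that path. Closing the
    path at the farthest of them gives a cycle through that vertex and all these neighbours. *)
Lemma min_degree_cycle (G : sgraph) (K : {set G}) d v0 :
  v0 \in K -> 1 < d -> (forall v, v \in K -> d <= #|nbhd v :&: K|) ->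
  exists c, [/\ is_cycle c, {subset c <= K} & d < size c].
Proof.
move=> v0K d_gt1 degK.
pose good (p : seq G) := [&& p != [::], sorted (@adj G) p, uniq p & all [in K] p].
have : exists2 p, good p & forall q, good q -> size q <= size p.
  suff H n : forall p, good p -> #|G| - size p <= n ->
      exists2 p, good p & forall q, good q -> size q <= size p.
    by apply: (H _ [:: v0]) (leqnn _); rewrite /good /= v0K.
  elim: n => [|n IHn] p gp.
    move=> le_n; exists p => // q /and4P[_ _ uq _].
    by rewrite -(card_uniqP uq) (leq_trans (max_card _)) // -subn_eq0 -leqn0.
  move=> le_n.
  have [lq|] := boolP [exists k : 'I_#|G|.+1, (size p < k) &&
      [exists q : k.-tuple G, good q]].
    case/existsP: lq => k /andP[lt_pk /existsP[q gq]].
    apply: (IHn q gq); rewrite size_tuple.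
    by move: #|G| (size p) (k : nat) le_n lt_pk => N P K'; lia.
  move=> /existsPn nq; exists p => // q gq; rewrite leqNgt; apply/negP => lt_pq.
  have [_ _ uq _] := and4P gq.
  have lt_q : size q < #|G|.+1 by rewrite ltnS -(card_uniqP uq) max_card.
  have := nq (Ordinal lt_q); rewrite lt_pq /= => /existsPn/(_ (in_tuple q)).
  by rewrite gq.
case=> -[//|u s] /and4P[_ /= ps us /andP[uK sK]] maxp.
have sub_s : {subset nbhd u :&: K <= s}.
  move=> v; rewrite !inE => /andP[uv vK]; apply/negPn/negP => vs.
  have /maxp : good (v :: u :: s); last by rewrite /= ltnn.
  rewrite /good /= vK uK sK ps adj_sym uv us !inE negb_or vs !andbT /=.
  by apply: contraTneq uv => ->; rewrite adj_irrefl.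
(* Searching [rev s] finds the farthest neighbour of [u]; [take i s] ends exactly there. *)
pose i := (size s) - find (adj u) (rev s).
pose c := u :: take i s.
have hasN : has (adj u) (rev s).
  have /card_gt0P[v vN] : 0 < #|nbhd u :&: K| by apply: leq_trans (degK u uK); lia.
  apply/hasP; exists v; first by rewrite mem_rev sub_s.
  by move: vN; rewrite !inE => /andP[].
have lt_f : find (adj u) (rev s) < size s by rewrite -[in leqRHS]size_rev -has_find.
have i_gt0 : 0 < i by rewrite /i; lia.
have le_is : i <= size s by rewrite /i; lia.
have adjl : adj u (last u (take i s)).
  have -> : last u (take i s) = nth u (rev s) (find (adj u) (rev s)).
    rewrite nth_rev // (last_nth u) size_takel //.
    have -> : size s - (find (adj u) (rev s)).+1 = i.-1 by rewrite /i; lia.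
    by rewrite -[in LHS](prednK i_gt0) /= nth_take // prednK.
  exact: nth_find.
have sub_c : {subset nbhd u :&: K <= take i s}.
  move=> v vN; have vs := sub_s v vN.
  rewrite in_take // ltnNge; apply/negP => le_iv.
  have lt_v : index v s < size s by rewrite index_mem.
  have := @before_find _ u (adj u) (rev s) (size s - (index v s).+1).
  rewrite nth_rev; last by lia.
  have -> : size s - (size s - (index v s).+1).+1 = index v s by lia.
  rewrite nth_index //; move: vN; rewrite !inE => /andP[-> _] H.
  by have : true = false by apply: H; rewrite /i in le_iv; lia.
have ut : uniq (take i s) by rewrite take_uniq //; case/andP: us.
have dc : d <= size (take i s).
  apply: leq_trans (degK u uK) _; rewrite cardE.
  apply: uniq_leq_size (enum_uniq _) _ => v; rewrite mem_enum; exact: sub_c.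
exists c; split.
- rewrite /is_cycle /ucycleb /c /= ut rcons_path take_path // adj_sym adjl /= andbT.
  rewrite ltnS (leq_trans d_gt1 dc) /=; case/andP: us => + _.
  by apply: contra; apply: mem_take.
- by move=> v; rewrite inE => /orP[/eqP->//|/mem_take/(allP sK)].
- by rewrite ltnS.
Qed.

(** * Counting, connectivity and minimum degree *)

Lemma leq_card_setD (T : finType) (A B : {set T}) : #|A| - #|B| <= #|A :\: B|.
Proof. by rewrite cardsD leq_sub2l // subset_leq_card // subsetIr. Qed.

(** With [h = #|D|./2], at most [2h - 1] indices lie at distance less than [h] from [j], too few for
    all of [D]. *)
Lemma far_index (T : finType) (D : {set T}) (idx : T -> nat) j :
  {in D &, injective idx} -> 0 < #|D| ->
  exists2 a, a \in D & #|D|./2 <= (idx a - j) + (j - idx a).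
Proof.
move=> inj D_gt0; apply/exists_inP.
rewrite -[X in is_true X]negbK; apply/negP; rewrite negb_exists_in => /forall_inP near.
have [h0|h_gt0] := posnP #|D|./2.
  by have /card_gt0P[a aD] := D_gt0; have := near a aD; rewrite h0.
have := @uniq_leq_size _ [seq idx a | a <- enum D] (iota (j.+1 - #|D|./2) (#|D|./2.*2.-1)).
rewrite map_inj_in_uniq ?enum_uniq; last first.
  by move=> x y; rewrite !mem_enum; apply: inj.
rewrite size_map -cardE size_iota => /(_ isT) H.
suff /H : {subset [seq idx a | a <- enum D] <= iota (j.+1 - #|D|./2) (#|D|./2.*2.-1)}.
  by move: #|D| h_gt0 => n; lia.
move=> _ /mapP[a + ->]; rewrite mem_enum mem_iota => /near.
by move: #|D| h_gt0 (idx a) => n; lia.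
Qed.

Lemma k_connected_path (G : sgraph) k (S : {set G}) x y :
  k_connected k G -> #|S| < k -> x \notin S -> y \notin S ->
  exists s, [/\ path (@adj G) x s, last x s = y
    & forall v, v \in x :: s -> v \notin S].
Proof.
move=> [_ /(_ S) conn] /conn{}conn xS yS.
have /connectP[s ps ls] := conn (Sub x xS) (Sub y yS).
exists (map val s); split.
- by rewrite -[x]/(val (Sub x xS : del_vertices S)) path_map.
- by rewrite -[x]/(val (Sub x xS : del_vertices S)) last_map -ls.
- rewrite -[x]/(val (Sub x xS : del_vertices S)) -map_cons => v.
  by case/mapP=> w _ ->; exact: (valP (w : {x : G | x \notin S})).
Qed.

(** Otherwise deleting the neighbourhood of [v] would cut [v] off from a further vertex, which
    exists since [k < #|G|]. *)
Lemma k_connected_degree (G : sgraph) k (v : G) : k_connected k G -> k <= degree v.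
Proof.
move=> kG; have [k_lt _] := kG; rewrite leqNgt; apply/negP => ltk.
have vN : v \notin nbhd v by rewrite inE adj_irrefl.
have : 0 < #|~: (v |: nbhd v)|.
  by rewrite cardsCs setCK subn_gt0 cardsU1 vN; apply: leq_ltn_trans ltk k_lt.
case/card_gt0P=> u; rewrite !inE negb_or => /andP[uv uN].
have uN' : u \notin nbhd v by rewrite inE.
have [[|w s] [/= ps ls off]] := k_connected_path kG ltk vN uN'.
  by rewrite ls eqxx in uv.
have := off w; rewrite !inE eqxx orbT => /(_ isT).
by case/andP: ps => ->.
Qed.

Lemma min_degree_le (G : sgraph) (v : G) : min_degree G <= degree v.
Proof.
rewrite /min_degree; elim: (index_enum G) (mem_index_enum v) => //= u r IHr.
rewrite inE big_cons => /orP[/eqP->|/IHr le_r]; first exact: geq_minl.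
by apply: leq_trans le_r; apply: geq_minr.
Qed.

Lemma k_connected_min_degree (G : sgraph) k : k_connected k G -> k <= min_degree G.
Proof.
move=> kG; rewrite /min_degree; elim/big_ind: _.
- by case: kG => /ltnW.
- by move=> m n km kn; rewrite leq_min km.
- by move=> v _; apply: k_connected_degree.
Qed.

(** A positive maximum is not the default value 0, so an actual path attains it. *)
Lemma longest_path_seq (G : sgraph) (S : {set G}) :
  0 < longest_path_length (del_vertices S) ->
  exists P : seq G, [/\ sorted (@adj G) P, uniq P,
    forall v, v \in P -> v \notin S
    & size P = (longest_path_length (del_vertices S)).+1].
Proof.
rewrite /longest_path_length; elim/big_ind: _ => //.
  by move=> m n IHm IHn; rewrite /maxn; case: (m < n); [apply: IHn | apply: IHm].
move=> n /existsP[t /and3P[_ st ut]] _; exists (map val t); split.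
- by rewrite sorted_map.
- by rewrite map_inj_uniq //; apply: val_inj.
- by move=> v /mapP[w _ ->]; exact: (valP (w : {x : G | x \notin S})).
- by rewrite size_map size_tuple.
Qed.

(** * Lower bounds for the length of a longest cycle *)

Lemma longest_cycle_gt_min_degree (G : sgraph) (X : seq G) :
  1 < min_degree G -> is_longest_cycle X -> min_degree G < size X.
Proof.
move=> d_gt1 [cX maxX].
have [x xX] : exists x, x \in X.
  by case: X cX {maxX} => // x s _; exists x; apply: mem_head.
have [|||c [cc _ lt_c]] := @min_degree_cycle G setT (min_degree G) x.
- by rewrite inE.
- by [].
- by move=> v _; rewrite setIT; apply: min_degree_le.
- by apply: leq_trans lt_c _; apply: maxX.
Qed.

(* If w is reached from d vertices of P and w' from b, one of those d vertices
   is at distance at least d / 2 from b on P, so the gap of X after w exceeds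
   d / 2; double counting then bounds the sum of the gaps from below. *)
Lemma linkage_to_rich_bound (G : sgraph) (X P : seq G) (B A' : {set G}) f d :
  let e := fun u v => [&& adj u v, u \notin X & v \notin X] in
  is_longest_cycle X -> sorted (@adj G) P -> uniq P ->
  (forall v, v \in P -> v \notin X) ->
  linkage e [set x in P] B A' f ->
  (forall a, a \in A' -> uniq (a :: f a) /\ forall v, v \in f a -> v \notin P) ->
  0 < #|A'| -> 1 < d ->
  (forall v, v \in B -> d <= #|nbhd v :&: [set x in X]|) ->
  #|A'| * d < 2 * size X.
Proof.
move=> e hX sP uP PX [sA f1 f2] f3 A_gt0 d_gt1 dB.
pose N a := nbhd (last a (f a)) :&: [set x in X].
(* [D w] holds the starts on [P] whose linkage path can be prolonged to [w]. *)
pose D w := [set a in A' | w \in N a].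
pose W := \bigcup_(a in A') N a.
have dN a : a \in A' -> d <= #|N a| by move=> /f1[_ /dB].
have sNW a : a \in A' -> N a \subset W by move=> aA; apply: (bigcup_sup a).
have W_gt1 : 1 < #|W|.
  have /card_gt0P[a aA] := A_gt0.
  by apply: leq_trans (subset_leq_card (sNW a aA)); apply: leq_trans (dN a aA).
have sWX : {subset W <= X}.
  by move=> w /bigcupP[a _]; rewrite !inE => /andP[].
have inP a : a \in A' -> a \in P by move=> /(subsetP sA); rewrite inE.
have ext a w : a \in A' -> w \in N a -> path (@adj G) a (rcons (f a) w).
  move=> aA; rewrite !inE rcons_path => /andP[-> _]; rewrite andbT.
  by have [pa _] := f1 a aA; apply: sub_path pa => ? ? /and3P[].
have offX a v : a \in A' -> v \in f a -> v \notin X.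
  move=> aA; have [pa _] := f1 a aA.
  have: path (fun u v => e u v && (v \notin [set x in X])) a (f a).
    by apply: sub_path pa => u w; rewrite /e !inE => /and3P[-> -> ->].
  by move=> /in_tail_path H /H; rewrite inE.
have gap w w' j : w \in W -> w' \in W -> w != w' ->
    iter j (next X) w = w' -> #|D w|./2 < j.
  move=> wW w'W ww' itj.
  have j_gt0 : 0 < j by case: j itj => // E; rewrite -E eqxx in ww'.
  have [->//|h_gt0] := posnP #|D w|./2.
  case/bigcupP: (w'W) => b bA w'b.
  have [||a aD far] := @far_index _ (D w) (index^~ P) (index b P).
  - move=> u v; rewrite !inE => /andP[/inP uP' _] /andP[/inP vP' _] /= E.
    by rewrite -(nth_index u uP') E nth_index.
  - by move: #|D w| h_gt0 => n; lia.
  move: aD; rewrite inE => /andP[aA wa].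
  have ab : a != b.
    by apply: contraTneq far => ->; rewrite subnn -ltnNge.
  have [t [pt lt ut tP st]] := path_between sP uP (inP a aA) (inP b bA).
  have le_j : (size t).+1 < j.
    apply: (detour_gap hX (sWX w wW) (sWX w' w'W) ww' _ _ itj) => //.
    apply: (@linkage_detour G X [set x in P] a b w w' (f a) (f b) t) => //.
    - by move=> v; rewrite inE; apply: PX.
    - exact: ext.
    - exact: ext.
    - by have [/andP[]] := f3 a aA.
    - by have [/andP[]] := f3 b bA.
    - by have [_ fP] := f3 a aA; move=> v /fP; rewrite inE.
    - by have [_ fP] := f3 b bA; move=> v /fP; rewrite inE.
    - by move=> v; apply: offX.
    - by move=> v; apply: offX.
    - move=> v va; apply/negP => vb; case/eqP: ab; apply: (f2 a b v) => //.
        by rewrite inE va orbT.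
      by rewrite inE vb orbT.
    - by move=> v /tP; rewrite inE.
  by apply: ltn_trans le_j; rewrite ltnS st.
have := sum_gaps hX W_gt1 sWX gap.
rewrite -(leq_pmul2l (isT : 0 < 2)); apply: leq_trans.
have count : \sum_(w in W) #|D w| = \sum_(a in A') #|N a|.
  under eq_bigr do rewrite -sum1dep_card big_mkcondr /=.
  rewrite exchange_big /=; apply: eq_bigr => a aA.
  rewrite -big_mkcondr -sum1_card; apply: eq_bigl => w.
  by rewrite andb_idl //; apply/subsetP/sNW.
(* The summand 1 absorbs the rounding in [#|D w|./2] and, as [W] is nonempty, makes the bound
   strict. *)
apply: (@leq_trans (\sum_(w in W) (#|D w|).+1)).
  rewrite (eq_bigr (fun w => #|D w| + 1)); last by move=> w _; rewrite addn1.
  rewrite big_split /= count sum1_card -addn1 leq_add //; last exact: ltnW.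
  by rewrite -sum_nat_const; apply: leq_sum => a /dN.
rewrite big_distrr /=; apply: leq_sum => w _.
by move: #|D w| => n; lia.
Qed.

Lemma cycle_off_bound (G : sgraph) (X C : seq G) k :
  1 < k -> k_connected k G -> is_longest_cycle X -> is_cycle C ->
  (forall v, v \in C -> v \notin X) ->
  minn k (size C) * (size C + 4) <= 2 * size X.
Proof.
move=> k_gt1 kG hX cC CX; set n := minn k (size C).
have [/andP[_ /andP[_ uX]] maxX] := hX.
have /andP[C_gt2 /andP[_ uC]] := cC.
have cardS (s : seq G) : uniq s -> #|[set x in s]| = size s.
  by move=> us; rewrite cardsE; apply/card_uniqP.
have n_gt1 : 1 < n by rewrite leq_min k_gt1 ltnW.
have [S sepS|A' [f [[sA f1 f2] cA f3]]] :=
    @menger_trimmed G (@adj G) [set x in C] [set x in X] n.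
  (* A set [S] smaller than [k] and [C] misses a vertex of [C] and one of [X], since [X] is no
     shorter than [C]; [k]-connectivity joins these two outside [S]. *)
  rewrite leqNgt; apply/negP; rewrite leq_min => /andP[ltk ltC].
  have [c] : exists c, c \in [set x in C] :\: S.
    apply/set0Pn; rewrite -card_gt0; apply: leq_trans (leq_card_setD _ _).
    by rewrite cardS // subn_gt0.
  have [x] : exists x, x \in [set x in X] :\: S.
    apply/set0Pn; rewrite -card_gt0; apply: leq_trans (leq_card_setD _ _).
    by rewrite cardS // subn_gt0 (leq_trans ltC) // maxX.
  rewrite !in_setD => /andP[xS xX] /andP[cS cC'].
  have [s [ps ls off]] := k_connected_path kG ltk cS xS.
  have := sepS c s cC' ps; rewrite ls => /(_ xX) /hasP[v /off vS].
  by rewrite /= (negPf vS).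
pose l a := last a (f a).
(* The interior of the linkage path: [belast] drops its end on [X], [behead] its start [a]. *)
pose p a := behead (belast a (f a)).
have inC a : a \in A' -> a \in C by move=> /(subsetP sA); rewrite inE.
have lX a : a \in A' -> l a \in X by case/f1; rewrite inE.
have fE a : a \in A' -> f a = rcons (p a) (l a).
  move=> aA; have := lX a aA; rewrite /p /l; case: (f a) => [|b s _] /=.
    by rewrite (negPf (CX a (inC a aA))).
  by rewrite lastI.
have pf a v : a \in A' -> v \in p a -> v \in f a.
  by move=> aA vp; rewrite fE // mem_rcons inE vp orbT.
have l_inj : {in A' &, injective l}.
  move=> a b aA bA lab; apply: (f2 a b (l a)) => //; first exact: mem_last.
  by rewrite lab; apply: mem_last.
pose W := [set l a | a in A'].
have cW : #|W| = n by rewrite card_in_imset.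
have sWX : {subset W <= X} by move=> _ /imsetP[a aA ->]; apply: lX.
have gap w w' j : w \in W -> w' \in W -> w != w' ->
    iter j (next X) w = w' -> (uphalf (size C)).+1 < j.
  case/imsetP=> a aA -> /imsetP[b bA ->] lab itj.
  have ab : a != b by apply: contraNneq lab => ->.
  have [t [pt lt ut tC st]] := cycle_between cC (inC a aA) (inC b bA) ab.
  apply: (@leq_ltn_trans (size t).+1); first by rewrite ltnS; move: (size t) st; lia.
  apply: (detour_gap hX (lX a aA) (lX b bA) lab _ _ itj) => //.
  have ppath c : c \in A' -> path (@adj G) c (rcons (p c) (l c)).
    by move=> cA'; rewrite -fE //; case: (f1 c cA').
  have pX c v : c \in A' -> v \in p c -> v \notin X.
    move=> cA' vp; have [_ _ /(_ v)] := f3 c cA'.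
    by rewrite inE; apply; move: vp; rewrite /p; case: (f c) => // u s; rewrite /= inE orbC => ->.
  have pC c v : c \in A' -> v \in p c -> v \notin [set x in C].
    by move=> cA' /(pf _ _ cA'); case: (f3 c cA') => _ + _; apply.
  have up c : c \in A' -> uniq (p c).
    by move=> cA'; case: (f3 c cA') => /= /andP[_] + _ _; rewrite fE // rcons_uniq => /andP[].
  apply: (@linkage_detour G X [set x in C] a b _ _ (p a) (p b) t) => //.
  - by move=> v; rewrite inE; apply: CX.
  - exact: ppath.
  - exact: ppath.
  - exact: up.
  - exact: up.
  - by move=> v; apply: pC.
  - by move=> v; apply: pC.
  - by move=> v; apply: pX.
  - by move=> v; apply: pX.
  - move=> v va; apply/negP => vb; case/eqP: ab; apply: (f2 a b v) => //.
      by rewrite inE pf ?orbT.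
    by rewrite inE pf ?orbT.
  - by move=> v /tC; rewrite inE.
have W_gt1 : 1 < #|W| by rewrite cW.
have := sum_gaps hX W_gt1 sWX gap; rewrite sum_nat_const cW => le_n.
(* Each path end accounts for [(uphalf (size C)).+2] vertices of [X]; doubling yields
   [size C + 4]. *)
apply: (@leq_trans (2 * (n * (uphalf (size C)).+2))); last by rewrite leq_pmul2l.
by rewrite mulnCA leq_mul2l; apply/orP; right; move: (size C) => c; lia.
Qed.

(* The component of X- and S-avoiding vertices around a vertex of P outside S
   contains no rich vertex, so its minimum degree is more than a third of
   [min_degree G]. *)
Lemma cycle_avoiding_rich (G : sgraph) (X P : seq G) (S : {set G}) s :
  let e := fun u v => [&& adj u v, u \notin X & v \notin X] in
  let rich := [set v | min_degree G <= 3 * #|nbhd v :&: [set x in X]|] in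
  uniq P -> (forall v, v \in P -> v \notin X) ->
  separates e [set x in P] rich S -> #|S| < s -> s <= size P ->
  3 * s <= min_degree G ->
  exists C, [/\ is_cycle C, forall v, v \in C -> v \notin X
    & min_degree G < 3 * size C].
Proof.
move=> e rich uP PX sepS lt_s le_sP le_sd.
have [v0] : exists v, v \in [set x in P] :\: S.
  apply/set0Pn; rewrite -card_gt0; apply: leq_trans (leq_card_setD _ _).
  rewrite cardsE (card_uniqP uP) subn_gt0; exact: leq_trans le_sP.
rewrite in_setD => /andP[v0S v0P].
have v0X : v0 \notin X by apply: PX; rewrite inE in v0P.
pose eS := fun u v => e u v && (v \notin S).
pose K := [set u | connect eS v0 u].
have KX u : u \in K -> [/\ u \notin X, u \notin S & u \notin rich].
  rewrite inE => /connectP[q pq ->].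
  have pq' : path e v0 q by apply: sub_path pq => ? ? /andP[].
  have offS v : v \in v0 :: q -> v \notin S.
    by rewrite inE => /orP[/eqP->//|]; apply: in_tail_path pq v.
  split.
  - case/lastP: q pq {pq' offS} => //= q v; rewrite rcons_path last_rcons.
    by case/andP=> _ /andP[/and3P[]].
  - by apply: offS; apply: mem_last.
  - apply/negP => lR; have /hasP[v /offS vS] := sepS v0 q v0P pq' lR.
    by rewrite /= (negPf vS).
(* Of the neighbours of [u], fewer than a third of [min_degree G] lie on [X] and fewer than a third
   in [S]; all the others are in [K]. *)
have degK u : u \in K -> (min_degree G %/ 3).+1 <= #|nbhd u :&: K|.
  move=> uK; have [uX uS uR] := KX u uK.
  have sub : (nbhd u :\: [set x in X]) :\: S \subset nbhd u :&: K.
    apply/subsetP => w; rewrite !inE => /and3P[wS wX uw]; rewrite uw /=.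
    rewrite inE in uK; apply: connect_trans uK (connect1 _).
    by rewrite /eS /e uw uX wX.
  have := leq_trans (leq_card_setD _ _) (subset_leq_card sub).
  have := cardsID [set x in X] (nbhd u); have := min_degree_le u.
  move: uR; rewrite inE -ltnNge /degree.
  move: #|_ :&: K| #|nbhd u :\: _| #|nbhd u :&: _| #|nbhd u| => a b c D.
  by move: (min_degree G) #|S| lt_s le_sd => d1 S1; lia.
have [|||C [cC CK lt_C]] := @min_degree_cycle G K (min_degree G %/ 3).+1 v0.
- by rewrite inE connect0.
- by move: (min_degree G) #|S| lt_s le_sd => d1 S1; lia.
- exact: degK.
exists C; split=> // [v /CK/KX[] //|].
by move: (min_degree G) (size C) lt_C => d1 c1; lia.
Qed.

Lemma longest_cycle_bound k (G : sgraph) (X : seq G) :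
  1 < k -> k_connected k G -> is_longest_cycle X ->
  (minn k (longest_path_length (del_vertices [set x in X])) - 2) * min_degree G
    < 25 * size X.
Proof.
move=> k_gt1 kG hX; set p := longest_path_length _.
set m := minn k p; set d := min_degree G.
have le_kd : k <= d := k_connected_min_degree kG.
have lt_dX : d < size X.
  by apply: longest_cycle_gt_min_degree => //; apply: leq_trans le_kd.
(* For [m] at most 27 the factor [m - 2] is at most 25, and [d < size X] suffices. *)
have [m_small|m_large] := leqP m 27.
  apply: (@leq_ltn_trans (25 * d)); last by rewrite ltn_pmul2l.
  by rewrite leq_mul2r; apply/orP; right; lia.
have le_md : m <= d by apply: leq_trans le_kd; apply: geq_minl.
have le_mp : m <= p := geq_minr _ _.
have [|P [sP uP PX' szP]] := @longest_path_seq G [set x in X].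
  by apply: leq_trans le_mp; apply: leq_trans m_large.
have PX v : v \in P -> v \notin X by move=> /PX'; rewrite inE.
set s := m %/ 3.
pose e u v := [&& adj u v, u \notin X & v \notin X].
pose rich : {set G} := [set v | d <= 3 * #|nbhd v :&: [set x in X]|].
rewrite ltnNge; apply/negP => le_X.
have [S sepS|A' [f [lf cA' f3]]] := @menger_trimmed G e [set x in P] rich s.
  rewrite leqNgt; apply/negP => lt_s.
  have [||C [cC CX lt_C]] := cycle_avoiding_rich uP PX sepS lt_s.
  - by rewrite szP; lia.
  - by rewrite -/d; lia.
  have le_C := cycle_off_bound k_gt1 kG hX cC CX.
  have le_n : m <= 3 * minn k (size C).
    by move: (size C) lt_C le_C => c; rewrite -/d; lia.
  move: (size C) (size X) (minn k (size C)) lt_C le_C le_n le_X.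
  rewrite -/d => c x n lt_C le_C le_n le_X.
  (* Together with [n * (c + 4) <= 2 * x] this gives [m * d <= 18 * x]. *)
  have : m * d <= (3 * n) * (3 * (c + 4)) by apply: leq_mul => //; lia.
  have : (m - 2) * d = m * d - 2 * d by rewrite mulnBl.
  by nia.
have A'P a : a \in A' -> uniq (a :: f a) /\ forall v, v \in f a -> v \notin P.
  by move=> /f3[ua fP _]; split=> // v /fP; rewrite inE.
have A'_gt0 : 0 < #|A'| by rewrite cA'; lia.
(* [(d + 2) %/ 3] is [d / 3] rounded up, the number of neighbours on [X] guaranteed by richness. *)
have d_gt1 : 1 < (d + 2) %/ 3 by lia.
have dB v : v \in rich -> (d + 2) %/ 3 <= #|nbhd v :&: [set x in X]|.
  by rewrite inE; move: #|_ :&: _| => n; lia.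
have := linkage_to_rich_bound hX sP uP PX lf A'P A'_gt0 d_gt1 dB.
(* Rounding in [s = m %/ 3] loses at most 2, whence the term [m - 2]. *)
rewrite cA'; have : (m - 2) * d <= (3 * s) * (3 * ((d + 2) %/ 3)).
  by apply: leq_mul; lia.
move: (size X) le_X => x; rewrite -/d.
by rewrite mulnACA; move: (s * ((d + 2) %/ 3)) ((m - 2) * d) => u w; lia.
Qed.

(** * The bound over the rationals *)

Import Order.TTheory GRing.Theory Num.Theory.
Local Open Scope ring_scope.

Theorem theorem7p1 (k : nat) (hk : (2 <= k)%N)
    (G : sgraph) (hG : k_connected k G)
    (X : seq G) (hX : is_longest_cycle X) :
  let p := longest_path_length (del_vertices [set x in X]) in
  ((minn k p)%:R - 2%:R) * (min_degree G)%:R / 25%:R < (size X)%:R :> rat.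
Proof.
cbv zeta; set p := longest_path_length _.
rewrite ltr_pdivrMr ?ltr0n // -natrM mulnC.
(* Truncated subtraction is never below the rational difference, so a negative left-hand side is
   covered too. *)
apply: (@le_lt_trans _ _ ((minn k p - 2) * min_degree G)%N%:R).
  rewrite natrM ler_wpM2r ?ler0n // lerBlDr -natrD ler_nat.
  by rewrite addnC -leq_subLR.
by rewrite ltr_nat; apply: longest_cycle_bound.
Qed.
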